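(* Let $H$ be a finitely generated subgroup of a free group $F(X)$, and let $\Gamma_H$ be the folding of $H$. If $H$ is positively generated (with respect to the basis $X$), then $\Gamma_H$ is a strongly connected directed graph.
   Context: For a finitely generated subgroup $H$ of a free group $F(X)$, the folding $\Gamma_H=(V_H,E_H)$ is the (Stallings) directed multigraph, loops allowed, with a distinguished vertex $1_H$ and with each directed edge labeled by an element of $X$, obtained as follows: take a finite set of freely reduced words generating $H$, form the rose consisting of one closed path at $1_H$ for each generator, labeled by the successive letters of that generator (a letter $x^{-1}$ corresponds to traversing an edge labeled $x$ backwards), and repeatedly identify pairs of edges that have the same label and the same head, or the same label and the same tail, until no such pair remains. Up to isomorphism the result depends only on $H$; it is a finite connected graph in which distinct edges with the same label have distinct heads and distinct tails, and the set of freely reduced elements of $H$ is the set of words read along closed non-backtracking walks starting and ending at $1_H$ (edges may be traversed in either direction). A word $w\in F(X)$ is positive (with respect to $X$) if its freely reduced form contains only symbols $x\in X$ and no symbol $x^{-1}$ with $x\in X$. $H$ is positively generated if there is $S\subseteq H$ with $\langle S\rangle=H$ and every $w\in S$ positive ($S$ need not be a basis). A directed graph is strongly connected if for all vertices $u,v$ either $u=v$, or there are a directed trail (a non-empty sequence of distinct edges, each starting where the previous one ends) from $u$ to $v$ and a directed trail from $v$ to $u$. *)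

(* Defs.v *)
From HB Require Import structures.
From mathcomp Require Import all_boot.
From mathcomp Require Import boolp classical_sets.

Set Implicit Arguments.
Unset Strict Implicit.
Unset Printing Implicit Defensive.

Local Open Scope classical_set_scope.

Section FreeGroup.
Variable X : choiceType.

(* The letter (x, true) stands for x and (x, false) for x^-1. *)
Definition letter := (X * bool)%type.

Definition opp_letter (l : letter) : letter := (l.1, ~~ l.2).

Definition reduced (w : seq letter) : bool :=
  sorted (fun a b => b != opp_letter a) w.

Definition cons_red (l : letter) (w : seq letter) : seq letter :=
  if w is l' :: w' then if l' == opp_letter l then w' else l :: w else [:: l].

Definition reduce (w : seq letter) : seq letter := foldr cons_red [::] w.

Lemma opp_letterK : involutive opp_letter.
Proof. by case=> x b; rewrite /opp_letter /= negbK. Qed.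

Lemma reduced_cons l w : reduced (l :: w) -> reduced w.
Proof. exact: path_sorted. Qed.

Lemma reduced_cons_red l w : reduced w -> reduced (cons_red l w).
Proof.
case: w => [|l' w] //= rw; case: eqP => [_|/eqP ne]; first exact: path_sorted rw.
by rewrite /= ne.
Qed.

Lemma cons_redE l w : reduced (l :: w) -> cons_red l w = l :: w.
Proof. by case: w => [|l' w] //= /andP[/negbTE ->]. Qed.

Lemma foldr_cons_red u v : reduced v -> reduced (foldr cons_red v u).
Proof. by move=> rv; elim: u => //= l u; apply: reduced_cons_red. Qed.

Lemma reduce_reduced w : reduced (reduce w).
Proof. exact: foldr_cons_red. Qed.

Lemma reduce_id w : reduced w -> reduce w = w.
Proof.
elim: w => //= l w IH rw; rewrite IH ?cons_redE //.
exact: reduced_cons rw.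
Qed.

Lemma cons_redK l w : reduced w -> cons_red l (cons_red (opp_letter l) w) = w.
Proof.
case: w => [_|l' w] /=; first by rewrite eqxx.
rewrite opp_letterK; case: eqP => [->|_] rw; last by rewrite /= eqxx.
exact: cons_redE.
Qed.

Lemma foldr_reduce u v :
  reduced v -> foldr cons_red v (reduce u) = foldr cons_red v u.
Proof.
move=> rv; elim: u => //= l u <-.
case Eu: (reduce u) => [|l' u'] //=.
case: eqP => [->|//]; rewrite cons_redK //; exact: foldr_cons_red.
Qed.

Lemma reduce_catl u v : reduce (reduce u ++ v) = reduce (u ++ v).
Proof. by rewrite /reduce !foldr_cat foldr_reduce // reduce_reduced. Qed.

Lemma reduce_catr u v : reduce (u ++ reduce v) = reduce (u ++ v).
Proof.
by rewrite /reduce !foldr_cat -!/(reduce _) (reduce_id (reduce_reduced v)).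
Qed.

Record free_group := FreeGroup {
  fg_word :> seq letter;
  fg_reduced : reduced fg_word
}.

HB.instance Definition _ := [isSub for fg_word].
HB.instance Definition _ := [Choice of free_group by <:].

Definition fg_one : free_group := @FreeGroup [::] isT.

Definition fg_mul (u v : free_group) : free_group :=
  FreeGroup (reduce_reduced (u ++ v)).

Definition inv_word (w : seq letter) : seq letter := rev (map opp_letter w).

Lemma reduced_inv_word w : reduced w -> reduced (inv_word w).
Proof.
rewrite /reduced /inv_word rev_sorted sorted_map; apply: sub_sorted => a b /=.
by rewrite opp_letterK eq_sym.
Qed.

Definition fg_inv (u : free_group) : free_group :=
  FreeGroup (reduced_inv_word (fg_reduced u)).

Lemma fg_mulA : associative fg_mul.
Proof.
move=> u v w; apply: val_inj => /=.
by rewrite reduce_catl reduce_catr catA.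
Qed.

Lemma fg_mul1 : left_id fg_one fg_mul.
Proof. by move=> u; apply: val_inj; rewrite /= reduce_id // fg_reduced. Qed.

Lemma fg_mulr1 : right_id fg_one fg_mul.
Proof. by move=> u; apply: val_inj; rewrite /= cats0 reduce_id // fg_reduced. Qed.

Lemma reduce_inv_word w : reduce (inv_word w ++ w) = [::].
Proof.
elim: w => //= l w IH; rewrite /inv_word /= rev_cons cat_rcons.
rewrite -[LHS]reduce_catr /=.
have := cons_redK (opp_letter l) (reduce_reduced w); rewrite opp_letterK => ->.
by rewrite reduce_catr.
Qed.

Lemma inv_wordK : involutive inv_word.
Proof.
move=> w; rewrite /inv_word map_rev revK -map_comp map_id_in // => l _.
exact: opp_letterK.
Qed.

Lemma fg_mulV : left_inverse fg_one fg_inv fg_mul.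
Proof. by move=> u; apply: val_inj; rewrite /= reduce_inv_word. Qed.

Lemma fg_mulrV : right_inverse fg_one fg_inv fg_mul.
Proof.
move=> u; apply: val_inj => /=.
by rewrite -{1}[fg_word u]inv_wordK reduce_inv_word.
Qed.

HB.instance Definition _ := isGroup.Build free_group
  fg_mulA fg_mul1 fg_mulr1 fg_mulV fg_mulrV.

Definition positive (w : free_group) : bool :=
  all (fun l : letter => l.2) (fg_word w).

End FreeGroup.

Definition is_subgroup (G : groupType) (H : set G) : Prop :=
  group_closed (mem H).

Definition generated (G : groupType) (S : set G) : set G :=
  smallest (@is_subgroup G) S.

Definition finitely_generated (G : groupType) (H : set G) : Prop :=
  exists s : seq G, generated [set` s] = H.

Definition positively_generated (X : choiceType) (H : set (free_group X)) :=
  exists S : set (free_group X),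
    [/\ S `<=` H, generated S = H & forall w, S w -> positive w].

(* The head of an edge is its target and the tail is its source. *)
Record lgraph (X : Type) := LGraph {
  vert : finType;
  edge : finType;
  src : edge -> vert;
  tgt : edge -> vert;
  lab : edge -> X;
  base : vert
}.

Section Graphs.
Variable X : Type.
Implicit Types G : lgraph X.

Record lgraph_hom G G' (fV : vert G -> vert G') (fE : edge G -> edge G') : Prop :=
  LGraphHom {
    hom_src : forall e, src (fE e) = fV (src e);
    hom_tgt : forall e, tgt (fE e) = fV (tgt e);
    hom_lab : forall e, lab (fE e) = lab e;
    hom_base : fV (base G) = base G'
  }.

Definition lgraph_iso G G' : Prop :=
  exists (fV : vert G -> vert G') (fE : edge G -> edge G'),
    [/\ lgraph_hom fV fE, bijective fV & bijective fE].

Definition foldable G (e1 e2 : edge G) : Prop :=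
  [/\ e1 <> e2, lab e1 = lab e2 & src e1 = src e2 \/ tgt e1 = tgt e2].

Definition folded G : Prop := forall e1 e2 : edge G, ~ foldable e1 e2.

Definition identifies (T : Type) (a b u v : T) : Prop :=
  [\/ u = v, u = a /\ v = b | u = b /\ v = a].

(* G' is, up to isomorphism, the quotient of G by the identification of e1
   with e2.  As e1 and e2 already share one endpoint, at most one pair of
   distinct vertices gets identified, so the conditions on fV do describe an
   equivalence relation. *)
Definition fold_step G G' : Prop :=
  exists (e1 e2 : edge G) (fV : vert G -> vert G') (fE : edge G -> edge G'),
    [/\ foldable e1 e2,
        lgraph_hom fV fE,
        (forall v', exists v, fV v = v') /\ (forall e', exists e, fE e = e'),
        forall u v, fV u = fV v <->
          identifies (src e1) (src e2) u v \/ identifies (tgt e1) (tgt e2) u v &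
        forall e e', fE e = fE e' <-> identifies e1 e2 e e'].

Inductive folds_to : lgraph X -> lgraph X -> Prop :=
| FoldsIso G G' of lgraph_iso G G' : folds_to G G'
| FoldsStep G G' G'' of fold_step G G' & folds_to G' G'' : folds_to G G''.

Definition directed_trail G (u v : vert G) (p : seq (edge G)) : Prop :=
  if p is e :: p' then
    [/\ uniq p, path (fun a b : edge G => tgt a == src b) e p', src e = u
      & tgt (last e p') = v]
  else False.

Definition strongly_connected G : Prop :=
  forall u v : vert G, u = v \/
    (exists p, directed_trail u v p) /\ (exists p, directed_trail v u p).

End Graphs.

(* Folding always terminates. *)
Lemma folds_to_folded (X : choiceType) (G : lgraph X) :
  exists2 G', folds_to G G' & folded G'.
Proof.
have [n] := ubnP #|edge G|; elim: n G => // n IH G ltn.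
have [fG|nfG] := pselect (folded G).
  exists G => //; apply: FoldsIso; exists id, id.
  by split=> //; exists id.
have [e1 [e2 fe]] : exists e1 e2 : edge G, foldable e1 e2.
  by apply: contrapT => no; apply: nfG => e1 e2 fe; apply: no; exists e1, e2.
have [ne eql eqv] := fe.
pose ab := if src e1 == src e2 then (tgt e1, tgt e2) else (src e1, src e2).
have kerP u v : identifies (src e1) (src e2) u v \/
    identifies (tgt e1) (tgt e2) u v <-> identifies ab.1 ab.2 u v.
  rewrite /ab; case: eqP => [->|ns] /=; split.
  - case=> // iuv; constructor 1.
    by case: iuv => [|[uE vE]|[uE vE]] //; rewrite uE vE.
  - by right.
  - case=> // iuv; constructor 1; case: eqv => // eqt; move: iuv; rewrite eqt.
    by case=> [|[uE vE]|[uE vE]] //; rewrite uE vE.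
  - by left.
pose c (T : eqType) (a b x : T) := if x == b then a else x.
have cc (T : eqType) (a b x : T) : c T a b (c T a b x) == c T a b x.
  by rewrite /c; case: (x =P b) => [_|/eqP/negbTE->] //; case: ifP.
have ckP (T : eqType) (a b x y : T) :
    c T a b x = c T a b y <-> identifies a b x y.
  rewrite /c; split; last first.
    by case=> [->|[-> ->]|[-> ->]] //; rewrite eqxx; case: ifP.
  case: eqP => [->|_]; case: eqP => [->|_] eqxy.
  - by constructor 1.
  - by constructor 3.
  - by constructor 2.
  - by constructor 1.
pose cV := c _ ab.1 ab.2; pose cE := c _ e1 e2.
pose V' : finType := {v : vert G | cV v == v}.
pose E' : finType := {e : edge G | cE e == e}.
pose fV v : V' := exist _ (cV v) (cc _ _ _ _).
pose fE e : E' := exist _ (cE e) (cc _ _ _ _).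
pose G' := @LGraph X V' E' (fun e => fV (src (val e)))
  (fun e => fV (tgt (val e))) (fun e => lab (val e)) (fV (base G)).
have fVP u v : fV u = fV v <-> identifies ab.1 ab.2 u v.
  by rewrite -ckP; split=> [[]|eqc] //; apply: val_inj.
have fEP e e' : fE e = fE e' <-> identifies e1 e2 e e'.
  by rewrite -ckP; split=> [[]|eqc] //; apply: val_inj.
have st : fold_step G G'.
  exists e1, e2, fV, fE; split=> //.
  - split=> //= e.
    + apply/fVP/kerP; rewrite /cE /c; case: eqP => [->|_]; left.
        by constructor 2.
      by constructor 1.
    + apply/fVP/kerP; rewrite /cE /c; case: eqP => [->|_]; right.
        by constructor 2.
      by constructor 1.
    + by rewrite /cE /c; case: eqP => [->|].
  - split=> -[x px].
    + by exists x; apply: val_inj; apply/eqP.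
    + by exists x; apply: val_inj; apply/eqP.
  - by move=> u v; rewrite kerP.
have ltE : #|edge G'| < #|edge G|.
  rewrite /= card_sig; apply: (@leq_trans #|[pred e in edge G]|); last first.
    by apply: max_card.
  apply: proper_card; rewrite properE; apply/andP; split.
    by apply/fintype.subsetP.
  apply/subsetPn; exists e2 => //; rewrite inE /= /cE /c eqxx.
  exact/eqP.
have [G'' toG'' fG''] := IH G' (leq_trans ltE ltn).
by exists G'' => //; apply: FoldsStep st toG''.
Qed.

Section Rose.
Variables (X : choiceType) (ws : seq (free_group X)).

Definition rose_word (i : 'I_(size ws)) : seq (letter X) :=
  fg_word (tnth (in_tuple ws) i).

(* None is the base vertex, and Some (i, j) is the vertex between the letters
   j and j + 1 (counted from 0) of the i-th word. *)
Definition rose_vert : finType :=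
  option {i : 'I_(size ws) & 'I_(size (rose_word i)).-1}.

Definition rose_edge : finType :=
  {i : 'I_(size ws) & 'I_(size (rose_word i))}.

(* The vertex reached after k letters of the i-th word; it is the base vertex
   for k = 0 and for k = size (rose_word i). *)
Definition rose_pos (i : 'I_(size ws)) (k : nat) : rose_vert :=
  if k is j.+1 then
    omap (@Tagged _ i (fun i => 'I_(size (rose_word i)).-1)) (insub j)
  else None.

Definition rose_letter (e : rose_edge) : letter X :=
  tnth (in_tuple (rose_word (tag e))) (tagged e).

Definition rose_src (e : rose_edge) : rose_vert :=
  if (rose_letter e).2 then rose_pos (tag e) (tagged e)
  else rose_pos (tag e) (tagged e).+1.

Definition rose_tgt (e : rose_edge) : rose_vert :=
  if (rose_letter e).2 then rose_pos (tag e) (tagged e).+1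
  else rose_pos (tag e) (tagged e).

Definition rose : lgraph X :=
  LGraph rose_src rose_tgt (fun e => (rose_letter e).1) None.

End Rose.

Definition is_folding (X : choiceType) (H : set (free_group X))
    (Gamma : lgraph X) : Prop :=
  exists ws : seq (free_group X),
    [/\ uniq ws, generated [set` ws] = H, folds_to (rose ws) Gamma
      & folded Gamma].

Lemma is_folding_exists (X : choiceType) (H : set (free_group X)) :
  finitely_generated H -> exists Gamma, is_folding H Gamma.
Proof.
case=> ws genH; have [G toG fG] := folds_to_folded (rose (undup ws)).
exists G; exists (undup ws); split=> //; first exact: undup_uniq.
rewrite -genH; congr generated; apply/seteqP.
by split=> w /=; rewrite mem_undup.
Qed.

(* Main.v *)
Require Import Defs.
From mathcomp Require Import all_boot.
From mathcomp Require Import boolp classical_sets.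

(** A reduced word of [H] is read along a closed walk at the base vertex of the
    folded graph [Gamma], because backtracks cancel there.  For a positive word
    this walk is directed, hence stays in the strong component [T] of the base
    vertex.  The words read along closed walks inside [T] form a subgroup, which
    thus contains the subgroup generated by any set of positive elements of [H].
    If that is all of [H], the petals of the rose are read inside [T]; since
    they cover every vertex of [Gamma], [T] is everything. *)

Set Implicit Arguments.
Unset Strict Implicit.
Unset Printing Implicit Defensive.

Local Open Scope classical_set_scope.

Section Walks.
Variable X : choiceType.
Implicit Types (G : lgraph X) (l : letter X) (w : seq (letter X)).

Definition step G (u : vert G) l (v : vert G) : Prop :=
  exists2 e, lab e = l.1 &
    if l.2 then src e = u /\ tgt e = v else tgt e = u /\ src e = v.

(** [T] constrains every vertex entered but not the start [u], so [T u] is assumed separately where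
    it matters. Words need not be reduced. *)
Fixpoint walk G (T : set (vert G)) (u : vert G) w (v : vert G) : Prop :=
  if w is l :: w' then exists u', [/\ step u l u', T u' & walk T u' w' v]
  else u = v.

Lemma step_opp G (u v : vert G) l : step u l v -> step v (opp_letter l) u.
Proof. by case: l => x [] [e /= le [eu ev]]; exists e. Qed.

Lemma step_inj G (u v v' : vert G) l :
  folded G -> step u l v -> step u l v' -> v = v'.
Proof.
move=> fG [e le eP] [e' le' eP'].
suff ee' : e = e'.
  by case: (l.2) eP eP' => -[_ <-] [_ <-]; rewrite ee'.
apply: contrapT => ne; apply: (fG e e'); split=> //; first by rewrite le.
by case: (l.2) eP eP' => -[-> _] [-> _]; [left|right].
Qed.

Lemma walk_cat G T (u v : vert G) a b :
  walk T u (a ++ b) v <-> exists2 u', walk T u a u' & walk T u' b v.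
Proof.
elim: a u => /= [|l a IH] u; first by split=> [|[_ ->]//]; exists u.
split=> [[u1 [s1 T1 /IH[u' wa wb]]]|[u' [u1 [s1 T1 wa]] wb]].
  by exists u' => //; exists u1.
by exists u1; split=> //; apply/IH; exists u'.
Qed.

Lemma walk_end G (T : set (vert G)) u w v : T u -> walk T u w v -> T v.
Proof. by elim: w u => [u Tu <-|l w IH u _ /= [u' [_ Tu' /IH]]] //; apply. Qed.

Lemma walk_inj G (T T' : set (vert G)) u w v v' :
  folded G -> walk T u w v -> walk T' u w v' -> v = v'.
Proof.
move=> fG; elim: w u => [u <- <-|l w IH u /= [u1 [s1 _ w1]] [u2 [s2 _ w2]]] //.
by move: w1; rewrite (step_inj fG s1 s2) => /IH; apply.
Qed.

Lemma walk_inv G (T : set (vert G)) u w v :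
  T u -> walk T u w v -> walk T v (inv_word w) u.
Proof.
elim: w u => [u _ -> //|l w IH u Tu /= [u' [s Tu' /(IH _ Tu') ww]]].
rewrite /inv_word /= rev_cons -cats1; apply/walk_cat; exists u' => //.
by exists u; split=> //; apply: step_opp.
Qed.

(** In a folded graph, reading [l] and then [opp_letter l] leads back to the same vertex. Cancelling
    the pair keeps the endpoints and only drops visited vertices. *)
Lemma walk_reduce G (T : set (vert G)) u w v :
  folded G -> walk T u w v -> walk T u (reduce w) v.
Proof.
move=> fG; elim: w u => //= l w IH u [u' [s Tu' /IH]].
case: (reduce w) => [|l' w'] /=; first by exists u'.
case=> u'' [s' Tu'' ww]; case: eqP => [l'E|_].
  by rewrite (step_inj fG (step_opp s) (v' := u'')) -?l'E.
by exists u'; split=> //; exists u''.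
Qed.

Lemma closed_walk_subgroup G (T : set (vert G)) : folded G -> T (base G) ->
  is_subgroup [set h : free_group X | walk T (base G) h (base G)].
Proof.
move=> fG Tb; split; rewrite ?inE //= => g h; rewrite !inE /= => wg wh.
by apply: walk_reduce => //; apply/walk_cat; exists (base G) => //; apply: walk_inv.
Qed.

Lemma walk_generated G (T : set (vert G)) (S : set (free_group X)) :
    folded G -> T (base G) ->
    (forall s, S s -> walk T (base G) s (base G)) ->
  forall h, generated S h -> walk T (base G) h (base G).
Proof.
move=> fG Tb ST h; apply: (smallest_sub (closed_walk_subgroup fG Tb)) => s.
exact: ST.
Qed.

Lemma hom_walk G G' (fV : vert G -> vert G') (fE : edge G -> edge G') u w v :
  lgraph_hom fV fE -> walk setT u w v -> walk setT (fV u) w (fV v).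
Proof.
move=> [hs ht hl _]; elim: w u => [u -> //|l w IH u /= [u' [[e le eP] _ /IH ww]]].
exists (fV u'); split=> //; exists (fE e); first by rewrite hl.
by rewrite hs ht; case: (l.2) eP => -[-> ->].
Qed.

(** The homomorphism carries walks of the rose to the folding; surjectivity on vertices carries over
    the covering by petals. *)
Lemma folds_to_hom G G' : folds_to G G' ->
  exists (fV : vert G -> vert G') (fE : edge G -> edge G'),
    lgraph_hom fV fE /\ forall v', exists v, fV v = v'.
Proof.
elim=> {G G'} [G G' [fV [fE [fh [gV _ fK] _]]]|G G' G''].
  by exists fV, fE; split=> // v'; exists (gV v').
case=> [_ [_ [fV [fE [_ [hs ht hl hb] [fsurj _] _ _]]]]] _.
case=> gV [gE [[hs' ht' hl' hb'] gsurj]].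
exists (gV \o fV), (gE \o fE); split.
  split=> [e|e|e|] /=; first by rewrite hs' hs.
  - by rewrite ht' ht.
  - by rewrite hl' hl.
  - by rewrite hb.
by move=> v''; have [v' <-] := gsurj v''; have [v <-] := fsurj v'; exists v.
Qed.

Lemma rose_walk (ws : seq (free_group X)) (i : 'I_(size ws)) k :
    k <= size (rose_word i) ->
  walk (G := rose ws) setT None (take k (rose_word i)) (rose_pos i k).
Proof.
elim: k => [_|k IH lek]; first by rewrite take0.
pose e : edge (rose ws) := Tagged (fun i => 'I_(size (rose_word i))) (Ordinal lek).
have le : rose_letter e = tnth (in_tuple (rose_word i)) (Ordinal lek) by [].
rewrite (take_nth (rose_letter e)) // -cats1; apply/walk_cat.
exists (rose_pos i k); first exact/IH/ltnW.
have -> : nth (rose_letter e) (rose_word i) k = rose_letter e.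
  by rewrite {2}le (tnth_nth (rose_letter e)).
exists (rose_pos i k.+1); split=> //; exists e => //.
by rewrite /= /rose_src /rose_tgt; case: ifP => ->.
Qed.

Lemma rose_petal (ws : seq (free_group X)) (w : free_group X) :
  w \in ws -> walk (G := rose ws) setT None w None.
Proof.
move=> /(tnthP (in_tuple ws))[i ->]; have := @rose_walk ws i _ (leqnn _).
rewrite take_size; suff -> : rose_pos i (size (rose_word i)) = None by [].
(* A word of length [n.+1] has only [n] inner vertices, so [insub n] fails and the petal closes at
   [None]. *)
case sz: (size _) => [|n] //=; rewrite insubF // sz; exact: ltnn.
Qed.

(** The suffix [b] is recorded because the full word [a ++ b] is a generator, hence lies in the
    subgroup, while the prefix [a] need not. *)
Lemma rose_cover (ws : seq (free_group X)) (v : vert (rose ws)) :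
  v = None \/ exists a b, a ++ b \in map (@fg_word X) ws /\
    walk (G := rose ws) setT None a v.
Proof.
case: v => [[i j]|]; last by left.
(* The inner vertex [(i, j)] comes after [j.+1] letters, since letters are counted from 0. *)
right; exists (take j.+1 (rose_word i)), (drop j.+1 (rose_word i)); split.
  by rewrite cat_take_drop; apply/map_f/mem_tnth.
have ltj : j.+1 <= size (rose_word i).
  by apply: ltnW; rewrite -ltn_predRL; apply: ltn_ord.
by have := rose_walk ltj; rewrite /rose_pos /= valK.
Qed.

Definition adj G : rel (vert G) :=
  fun u v => [exists e, (src e == u) && (tgt e == v)].

Lemma path_edges G (u v : vert G) q : path (@adj G) u (v :: q) ->
  exists e es, [/\ src e = u, path (fun a b => tgt a == src b) e es,
    tgt (last e es) = last v q & map (@src X G) (e :: es) = belast u (v :: q)].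
Proof.
elim: q u v => [|v' q IH] u v /=.
  by rewrite andbT => /existsP[e /andP[/eqP eu /eqP ev]]; exists e, [::]; rewrite /= eu.
case/andP=> /existsP[e /andP[/eqP eu /eqP ev]] /IH[e' [es [e'v pes les sE]]].
exists e, (e' :: es); split; rewrite ?les /= ?ev ?e'v ?eqxx ?eu //.
by move: sE => /= [_ ->].
Qed.

(** A path shortened to have distinct vertices uses edges with distinct sources, so no edge repeats;
    [u <> v] excludes the empty path. *)
Lemma connect_trail G (u v : vert G) :
  connect (@adj G) u v -> u <> v -> exists p, directed_trail u v p.
Proof.
case/connectP=> p /shortenP[[|v' q] pq uq _] -> // _.
have [e [es [eu pes les sE]]] := path_edges pq.
exists (e :: es); split=> //; apply: (map_uniq (f := @src X G)).
by move: uq; rewrite sE lastI rcons_uniq => /andP[].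
Qed.

Definition scc G (u : vert G) : set (vert G) :=
  [set v | connect (@adj G) u v /\ connect (@adj G) v u].

(** Every edge is crossed forwards, so a visited vertex is reachable from [b] through the part
    already read and reaches [b] through the rest. The second conclusion carries the latter back
    along the induction. *)
Lemma positive_walk_scc G (b u v : vert G) w : all (fun l : letter X => l.2) w ->
  connect (@adj G) b u -> connect (@adj G) v b ->
  walk setT u w v -> walk (scc b) u w v /\ connect (@adj G) u b.
Proof.
elim: w u => [u _ _ vb -> //|[x []] //= w IH] u pw bu vb [u' [[e le /= [eu ev]] _ ww]].
have uu' : connect (@adj G) u u'.
  by apply/connect1/existsP; exists e; rewrite eu ev !eqxx.
have bu' := connect_trans bu uu'.
have [ww' u'b] := IH u' pw bu' vb ww.
split; last exact: connect_trans u'b.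
by exists u'; split=> //; exists e.
Qed.

Lemma scc_strongly_connected G (b : vert G) :
  (forall v, scc b v) -> strongly_connected G.
Proof.
move=> Tb u v; have [->|/eqP uv] := eqVneq u v; first by left.
have [[bu ub] [bv vb]] := (Tb u, Tb v).
right; split; apply: connect_trail => //; last exact/nesym.
  exact: connect_trans bv.
exact: connect_trans bu.
Qed.

End Walks.

Theorem lemma3p4 (X : choiceType) (H : set (free_group X)) (Gamma : lgraph X)
    (subgroup_H : is_subgroup H) (fg_H : finitely_generated H)
    (folding_H : is_folding H Gamma) (posgen_H : positively_generated H) :
  strongly_connected Gamma.
Proof.
have [ws [_ genws /folds_to_hom[fV [fE [fh fsurj]]] fG]] := folding_H.
have [S [SH genS posS]] := posgen_H.
have rose_image a v : walk (G := rose ws) setT None a v ->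
    walk setT (base Gamma) a (fV v).
  by move=> /(hom_walk fh); rewrite (hom_base fh).
pose T := scc (base Gamma).
have Tb : T (base Gamma) by [].
have HT h : H h -> walk T (base Gamma) h (base Gamma).
  rewrite -genS; apply: walk_generated => // s Ss.
  apply: (proj1 (positive_walk_scc (posS s Ss) _ _ _)) => //.
  (* That [s] labels a closed walk at all comes from a second use of [walk_generated], with the
     generators [ws] and no constraint on vertices. *)
  have := SH s Ss; rewrite -genws; apply: walk_generated => // w.
  by move=> /rose_petal/rose_image; rewrite -(hom_base fh).
apply: (@scc_strongly_connected X Gamma (base Gamma)) => v.
have [v0 <-] := fsurj v.
have [->|[a [b [/mapP[w wws abE] /rose_image wa]]]] := rose_cover v0.
  by have -> : fV None = base Gamma by exact: hom_base fh.
have : H w by rewrite -genws; apply: sub_gen_smallest.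
move=> /HT; rewrite -abE => /walk_cat[u' wa' _].
(* The prefix [a] is read from the base both to [fV v0] and, inside [T], to [u']; determinism of the
   folded graph identifies the two ends. *)
by rewrite (walk_inj fG wa wa'); apply: walk_end wa'.
Qed.
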